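(* For every positive integer $m$ there are a finite alphabet $\Sigma$, a sentence $\varphi_m\in\mathrm{FO}^2_m[<,\mathrm{suc}]$ and two languages $K_m,L_m\subseteq\Sigma^\star$ such that $\varphi_m$ separates $K_m$ and $L_m$, but no sentence $\psi\in\mathrm{FO}^2_{m-1}[<,\mathrm{suc}]$ separates $K_m$ and $L_m$.
   Context: Words are finite structures with universe $\{1,\dots,|w|\}$, unary predicates $Q_a$ ($a\in\Sigma$) marking positions carrying $a$, the order $<$ and the successor relation $\mathrm{suc}(z,z')\iff z'=z+1$. $\mathrm{FO}^2_n[<,\mathrm{suc}]$ is first-order logic over this signature using only the variables $x,y$ with quantifier depth at most $n$; $\mathrm{FO}^2_{m,n}[<,\mathrm{suc}]$ is the set of its formulas in which every path in the parse tree has at most $m$ blocks of alternating quantifiers, and $\mathrm{FO}^2_m[<,\mathrm{suc}]=\bigcup_{n\ge m}\mathrm{FO}^2_{m,n}[<,\mathrm{suc}]$. A formula $\varphi$ separates $K,L$ if every word of $K$ satisfies $\varphi$ and no word of $L$ does, or vice versa. *)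

(* Defs.v *)
From mathcomp Require Import all_boot.
Set Implicit Arguments. Unset Strict Implicit. Unset Printing Implicit Defensive.

Inductive var := VX | VY.
Definition var_eqb (u v : var) : bool :=
  match u, v with VX, VX | VY, VY => true | _, _ => false end.

(* FO^2[<,suc] formulas over alphabet Sigma, in negation normal form
   (negation only in front of atoms), which makes "blocks of alternating
   quantifiers" unambiguous. *)
Inductive form (Sigma : Type) :=
| FTrue | FFalse
| FLetter (a : Sigma) (v : var)
| FNLetter (a : Sigma) (v : var)
| FLt (u v : var)
| FNLt (u v : var)
| FSuc (u v : var)
| FNSuc (u v : var)
| FEq (u v : var)
| FNEq (u v : var)
| FAnd (f g : form Sigma)
| FOr (f g : form Sigma)
| FEx (v : var) (f : form Sigma)
| FAll (v : var) (f : form Sigma).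
Arguments FTrue {Sigma}. Arguments FFalse {Sigma}.

(* Positions of a word w are 0, ..., size w - 1 (shifted from 1..|w|). *)
Fixpoint sat (Sigma : eqType) (w : seq Sigma) (s : var -> nat) (f : form Sigma)
  : Prop :=
  match f with
  | FTrue => True
  | FFalse => False
  | FLetter a v => s v < size w /\ nth a w (s v) = a
  | FNLetter a v => ~ (s v < size w /\ nth a w (s v) = a)
  | FLt u v => s u < s v
  | FNLt u v => ~ (s u < s v)
  | FSuc u v => s v = (s u).+1
  | FNSuc u v => s v <> (s u).+1
  | FEq u v => s u = s v
  | FNEq u v => s u <> s v
  | FAnd f g => sat w s f /\ sat w s g
  | FOr f g => sat w s f \/ sat w s g
  | FEx v f => exists i, i < size w /\
                 sat w (fun u => if var_eqb u v then i else s u) f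
  | FAll v f => forall i, i < size w ->
                 sat w (fun u => if var_eqb u v then i else s u) f
  end.

Fixpoint free (Sigma : Type) (x : var) (f : form Sigma) : bool :=
  match f with
  | FTrue | FFalse => false
  | FLetter _ v | FNLetter _ v => var_eqb x v
  | FLt u v | FNLt u v | FSuc u v | FNSuc u v | FEq u v | FNEq u v =>
      var_eqb x u || var_eqb x v
  | FAnd f g | FOr f g => free x f || free x g
  | FEx v f | FAll v f => ~~ var_eqb x v && free x f
  end.

Definition sentence (Sigma : Type) (f : form Sigma) : Prop :=
  ~~ free VX f /\ ~~ free VY f.

Fixpoint qdepth (Sigma : Type) (f : form Sigma) : nat :=
  match f with
  | FAnd f g | FOr f g => maxn (qdepth f) (qdepth g)
  | FEx _ f | FAll _ f => (qdepth f).+1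
  | _ => 0
  end.

(* Maximal number of blocks of alternating quantifiers along a path of the
   parse tree; [q] is the kind of the nearest enclosing quantifier
   (None: no enclosing quantifier, Some true: exists, Some false: forall). *)
Fixpoint blocks (Sigma : Type) (q : option bool) (f : form Sigma) : nat :=
  match f with
  | FAnd f g | FOr f g => maxn (blocks q f) (blocks q g)
  | FEx _ f => (if q == Some true then 0 else 1) + blocks (Some true) f
  | FAll _ f => (if q == Some false then 0 else 1) + blocks (Some false) f
  | _ => 0
  end.

Definition alternation (Sigma : Type) (f : form Sigma) : nat := blocks None f.

Definition FO2_mn (Sigma : Type) (m n : nat) (f : form Sigma) : Prop :=
  qdepth f <= n /\ alternation f <= m.
Definition FO2_m (Sigma : Type) (m : nat) (f : form Sigma) : Prop :=
  exists n, m <= n /\ FO2_mn m n f.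

(* truth of a sentence in a word (assignment irrelevant for sentences) *)
Definition models (Sigma : eqType) (w : seq Sigma) (f : form Sigma) : Prop :=
  sat w (fun _ => 0) f.

Definition separates (Sigma : eqType) (f : form Sigma)
  (K L : seq Sigma -> Prop) : Prop :=
  ((forall w, K w -> models w f) /\ (forall w, L w -> ~ models w f)) \/
  ((forall w, L w -> models w f) /\ (forall w, K w -> ~ models w f)).

(* Main.v *)
Require Import Defs.
From Stdlib Require Import Classical.
From mathcomp Require Import all_boot zify.
Set Implicit Arguments. Unset Strict Implicit. Unset Printing Implicit Defensive.

(** With S = m - 1, an onion is a core 0^c wrapped in layers s = 1, ..., S, put
    alternately on the right and on the left; the layer s is a high power of a
    block containing exactly the letters 0, ..., s. Cutting at the first
    (resp. last) S, then S - 1, ..., then 1 isolates the core, so "some 0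
    survives all cuts" is a sentence with m blocks telling c = 1 from c = 0.
    With m - 1 blocks the two onions cannot be told apart: in the
    Ehrenfeucht-Fraisse game with a bounded number of moves, the duplicator
    copies the moves outside a neighbourhood of the core, and this neighbourhood
    only needs to grow by one layer when the spoiler switches words. Finally,
    letters are separated by long runs of a padding letter, which makes the
    successor relation useless. *)

(** * Simulations and preservation of sentences *)

Definition lt_agree (i i' j j' : nat) : Prop :=
  (i < i') = (j < j') /\ (i' < i) = (j' < j).

Definition suc_agree (i i' j j' : nat) : Prop :=
  [/\ lt_agree i i' j j', (i' == i.+1) = (j' == j.+1)
    & (i == i'.+1) = (j == j'.+1)].

(** A winning strategy for the duplicator: [Z k n c d i j] holds when the spoiler plays in [w c] and
    may still switch words [k] times and move [n] times. One pebble pair suffices: with two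
    variables, a move replaces one pebble and only the other is left to compare with. *)
Record simulation (agree : nat -> nat -> nat -> nat -> Prop)
    (Sigma : eqType) (T : Type) (w : T -> seq Sigma) (K n0 : nat)
    (Z : nat -> nat -> T -> T -> nat -> nat -> Prop) : Prop := Simulation {
  sim_label : forall k n c d i j, k < K -> n <= n0 -> Z k n c d i j ->
    [/\ i < size (w c), j < size (w d) &
        forall a, nth a (w c) i = nth a (w d) j];
  sim_init : forall k n c d i, k < K -> n <= n0 -> i < size (w c) ->
    exists j, Z k n c d i j;
  sim_forth : forall k n c d i j i', k < K -> n < n0 -> Z k n.+1 c d i j ->
    i' < size (w c) -> exists2 j', Z k n c d i' j' & agree i i' j j';
  sim_drop : forall k n c d i j, k.+1 < K -> n <= n0 ->
    Z k.+1 n c d i j -> Z k n d c j i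
}.

Definition upd (s : var -> nat) (v : var) (i : nat) : var -> nat :=
  fun u => if var_eqb u v then i else s u.

Definition simulated (R : nat -> nat -> Prop) (Fv : pred var)
    (s s' : var -> nat) : Prop :=
  (forall v, Fv v -> R (s v) (s' v)) /\
  (forall u v, Fv u -> Fv v -> suc_agree (s u) (s v) (s' u) (s' v)).

Lemma suc_agreexx i j : suc_agree i i j j.
Proof. by split; [split; rewrite !ltnn| |]; lia. Qed.

Lemma suc_agreeC i i' j j' : suc_agree i i' j j' -> suc_agree i' i j' j.
Proof. by case=> -[? ?] ? ?. Qed.

Lemma suc_agree_sym i i' j j' : suc_agree i i' j j' -> suc_agree j j' i i'.
Proof. by rewrite /suc_agree /lt_agree => -[[-> ->] -> ->]. Qed.

Lemma suc_agree_eq i i' j j' : suc_agree i i' j j' -> (i == i') = (j == j').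
Proof. by case=> -[A B] _ _; lia. Qed.

Lemma simulated_sub R (F G : pred var) s s' :
  (forall v, G v -> F v) -> simulated R F s s' -> simulated R G s s'.
Proof. by move=> GF [A B]; split=> [v /GF/A //|u v /GF Fu /GF Fv]; apply: B. Qed.

Lemma simulated_flip (R R' : nat -> nat -> Prop) (F : pred var) s s' :
  (forall i j, R i j -> R' j i) -> simulated R F s s' -> simulated R' F s' s.
Proof.
by move=> RR [A B]; split=> [v /A/RR //|u v Fu Fv]; apply/suc_agree_sym/B.
Qed.

Section SimulationTheory.
Context (Sigma : eqType) (T : Type) (w : T -> seq Sigma) (K n0 : nat).
Context (Z : nat -> nat -> T -> T -> nat -> nat -> Prop).
Context (simZ : simulation suc_agree w K n0 Z).

(** The spoiler may replay a pebble where it stands; agreement on equality forces the old reply. *)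
Lemma sim_mono k n c d i j :
  k < K -> n < n0 -> Z k n.+1 c d i j -> Z k n c d i j.
Proof.
move=> kK nn zij; have [si _ _] := sim_label simZ kK nn zij.
have [j' zij' /suc_agree_eq] := sim_forth simZ kK nn zij si.
by rewrite eqxx => /esym/eqP->.
Qed.

Lemma simulated_move k n c d (f : form Sigma) v s s' i :
  k < K -> n < n0 -> i < size (w c) ->
  simulated (Z k n.+1 c d) (fun u => ~~ var_eqb u v && free u f) s s' ->
  exists2 j, j < size (w d) &
    simulated (Z k n c d) (fun u => free u f) (upd s v i) (upd s' v j).
Proof.
move=> kK nn si [A B].
pose v' := if v is VX then VY else VX.
have vv' u : u = v \/ u = v' by rewrite /v'; case: (u); case: (v); auto.
have nv : var_eqb v' v = false by rewrite /v'; case: (v).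
have rv : var_eqb v v by case: (v).
have [j zij ag] : exists2 j, Z k n c d i j &
    free v' f -> suc_agree (s v') i (s' v') j.
  case: (boolP (free v' f)) => [fv'|_].
    by have [|j z a] := sim_forth simZ kK nn (A v' _) si; [rewrite nv | exists j].
  by have [j z] := sim_init simZ d kK (ltnW nn) si; exists j.
exists j; first by have [] := sim_label simZ kK (ltnW nn) zij.
split=> [u fu|u1 u2]; rewrite /upd.
  case: (vv' u) fu => -> fu; rewrite ?rv // nv.
  by apply: sim_mono => //; apply: A; rewrite nv.
case: (vv' u1) (vv' u2) => -> [] -> f1 f2; rewrite ?rv ?nv.
- exact: suc_agreexx.
- by apply/suc_agreeC/ag.
- exact: ag.
- exact: suc_agreexx.
Qed.

(** The spoiler plays in [w c] inside an existential block and in [w d] inside a universal one,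
    while truth always passes from [w c] to [w d]. Continuing a block costs only moves; opening one
    of the other kind costs a switch. *)
Lemma sim_sat (f : form Sigma) : forall k n c d s s',
  k < K -> n <= n0 -> qdepth f <= n ->
  (blocks (Some true) f <= k ->
   simulated (Z k n c d) (fun u => free u f) s s' ->
   sat (w c) s f -> sat (w d) s' f) /\
  (blocks (Some false) f <= k ->
   simulated (Z k n d c) (fun u => free u f) s' s ->
   sat (w c) s f -> sat (w d) s' f).
Proof.
have rv v : var_eqb v v by case: v.
have lab k n c d s s' a v : k < K -> n <= n0 ->
    simulated (Z k n c d) (fun u => var_eqb u v) s s' ->
    (s v < size (w c) /\ nth a (w c) (s v) = a) <->
    (s' v < size (w d) /\ nth a (w d) (s' v) = a).
  move=> kK nn [/(_ v (rv v)) z _].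
  by have [-> -> ->] := sim_label simZ kK nn z.
have at2 k n c d s s' u v :
    simulated (Z k n c d) (fun x => var_eqb x u || var_eqb x v) s s' ->
    suc_agree (s u) (s v) (s' u) (s' v).
  by case=> _ A; apply: A; rewrite rv ?orbT.
elim: f => [||a v|a v|u v|u v|u v|u v|u v|u v|f IHf g IHg|f IHf g IHg|v f IHf|v f IHf]
  k n c d s s' kK nn /=.
- by [].
- by [].
- by move=> _; split=> _ /lab H; rewrite H.
- by move=> _; split=> _ /lab H; rewrite H.
- by move=> _; split=> _ /at2[[-> _] _ _].
- by move=> _; split=> _ /at2[[-> _] _ _].
- by move=> _; split=> _ /at2[_ E _]; lia.
- by move=> _; split=> _ /at2[_ E _]; lia.
- by move=> _; split=> _ /at2/suc_agree_eq E; lia.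
- by move=> _; split=> _ /at2/suc_agree_eq E; lia.
- rewrite geq_max => /andP[qf qg]; split; rewrite geq_max => /andP[bf bg] sm [sf sg].
  + split; [apply: (proj1 (IHf k n c d s s' kK nn qf)) sf|
            apply: (proj1 (IHg k n c d s s' kK nn qg)) sg] => //;
      by apply: simulated_sub sm => v /= ->; rewrite ?orbT.
  + split; [apply: (proj2 (IHf k n c d s s' kK nn qf)) sf|
            apply: (proj2 (IHg k n c d s s' kK nn qg)) sg] => //;
      by apply: simulated_sub sm => v /= ->; rewrite ?orbT.
- rewrite geq_max => /andP[qf qg]; split; rewrite geq_max => /andP[bf bg] sm [sf|sg].
  + left; apply: (proj1 (IHf k n c d s s' kK nn qf)) sf => //.
    by apply: simulated_sub sm => v /= ->; rewrite ?orbT.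
  + right; apply: (proj1 (IHg k n c d s s' kK nn qg)) sg => //.
    by apply: simulated_sub sm => v /= ->; rewrite ?orbT.
  + left; apply: (proj2 (IHf k n c d s s' kK nn qf)) sf => //.
    by apply: simulated_sub sm => v /= ->; rewrite ?orbT.
  + right; apply: (proj2 (IHg k n c d s s' kK nn qg)) sg => //.
    by apply: simulated_sub sm => v /= ->; rewrite ?orbT.
- case: n nn => // n nn; rewrite ltnS => qf.
  have step k' : k' < K -> blocks (Some true) f <= k' ->
      simulated (Z k' n.+1 c d) (fun u => ~~ var_eqb u v && free u f) s s' ->
      (exists i, i < size (w c) /\ sat (w c) (upd s v i) f) ->
      exists j, j < size (w d) /\ sat (w d) (upd s' v j) f.
    move=> k'K bf sm [i [si sf]]; have [j sj sm'] := simulated_move k'K nn si sm.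
    exists j; split=> //; exact: (proj1 (IHf k' n c d _ _ k'K (ltnW nn) qf)) sf.
  split=> [|bf sm]; first exact: step.
  (* The change of quantifier makes the block count positive, so a switch is available. *)
  case: k kK bf sm => // k kK bf sm; apply: (step k) => //; first exact: ltnW.
  by apply: simulated_flip sm => i j; apply: (sim_drop simZ).
- case: n nn => // n nn; rewrite ltnS => qf.
  have step k' : k' < K -> blocks (Some false) f <= k' ->
      simulated (Z k' n.+1 d c) (fun u => ~~ var_eqb u v && free u f) s' s ->
      (forall i, i < size (w c) -> sat (w c) (upd s v i) f) ->
      forall j, j < size (w d) -> sat (w d) (upd s' v j) f.
    move=> k'K bf sm sf j sj; have [i si sm'] := simulated_move k'K nn sj sm.
    exact: (proj2 (IHf k' n c d _ _ k'K (ltnW nn) qf)) (sf i si).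
  split=> [bf sm|]; last exact: step.
  case: k kK bf sm => // k kK bf sm; apply: (step k) => //; first exact: ltnW.
  by apply: simulated_flip sm => i j; apply: (sim_drop simZ).
Qed.

(** Below the outer connectives, the first quantifier chooses the starting word for free, so [K]
    blocks need only [K - 1] switches. *)
Lemma sim_sentence (f : form Sigma) c d s s' :
  ~~ free VX f -> ~~ free VY f -> qdepth f <= n0 -> alternation f <= K ->
  sat (w c) s f -> sat (w d) s' f.
Proof.
have closed (g : form Sigma) R t t' : ~~ free VX g -> ~~ free VY g ->
    simulated R (fun u => free u g) t t'.
  by move=> gx gy; split=> [[]|[] u] => H; move: gx gy; rewrite H.
elim: f => //=.
- by move=> a [].
- by move=> a [].
- by case.
- by case.
- by case.
- by case.
- by case.
- by case.
- move=> f IHf g IHg; rewrite !negb_or => /andP[? ?] /andP[? ?].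
  by rewrite /alternation /= !geq_max => /andP[? ?] /andP[? ?] [? ?]; split; auto.
- move=> f IHf g IHg; rewrite !negb_or => /andP[? ?] /andP[? ?].
  by rewrite /alternation /= !geq_max => /andP[? ?] /andP[? ?] [?|?]; auto.
- move=> v f _ fx fy qf; rewrite /alternation /= add1n => bf.
  have kK : K.-1 < K by lia.
  have [H _] := @sim_sat (FEx v f) K.-1 n0 c d s s' kK (leqnn _) qf.
  by apply: H; [rewrite /= add0n; lia | apply: closed].
- move=> v f _ fx fy qf; rewrite /alternation /= add1n => bf.
  have kK : K.-1 < K by lia.
  have [_ H] := @sim_sat (FAll v f) K.-1 n0 c d s s' kK (leqnn _) qf.
  by apply: H; [rewrite /= add0n; lia | apply: closed].
Qed.

End SimulationTheory.

(** * Neutralising the successor relation by padding *)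

(** Counting positions from 1, the letter l sits at (l + 1) M, with M - 1 padding letters on each
    side, also at both ends of the word. *)
Definition pad (Sigma : Type) (f : nat -> Sigma) (p : Sigma) (M : nat)
    (u : seq nat) : seq Sigma :=
  mkseq (fun i => if M %| i.+1 then f (nth 0 u (i.+1 %/ M).-1) else p)
        ((size u).+1 * M).-1.

Section Padding.
Context (Sigma : eqType) (f : nat -> Sigma) (p : Sigma) (M : nat).

Lemma size_pad u : size (pad f p M u) = ((size u).+1 * M).-1.
Proof. exact: size_mkseq. Qed.

Lemma nth_pad a u i : i < size (pad f p M u) ->
  nth a (pad f p M u) i =
  if M %| i.+1 then f (nth 0 u (i.+1 %/ M).-1) else p.
Proof. by rewrite size_pad => si; rewrite nth_mkseq. Qed.

(* The position x = i + 1 is described relative to the letter l at (l + 1) M,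
   from which it is less than M away. With n moves left it must keep a
   distance n from the neighbouring letters. *)
Definition near (L n l x : nat) : Prop :=
  [/\ l < L, l * M < x < l.+2 * M, x + n < l.+2 * M \/ l.+1 = L
    & l * M + n < x \/ l = 0].

Lemma near_right L n x : n.*2 < M -> 0 < L -> 0 < x < L.+1 * M ->
  exists2 l, near L n l x & l.+1 * M <= x + n \/ l = 0.
Proof.
move=> nM L0 /andP[x0 xL]; have M0 : 0 < M by lia.
have := divn_eq (x + n) M; have := ltn_pmod (x + n) M0.
set q := _ %/ M; set r := _ %% M => rM E.
have qL : q <= L.+1.
  by rewrite -ltnS /q ltn_divLR //; lia.
case: q qL E => [_ E|q qL E].
  by exists 0; [split; lia | right].
case: (leqP q.+1 L) => [qL'|qL'].
  by exists q; [split|]; lia.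
case: L L0 xL qL qL' => // L _ xL qL qL'.
have EqL : q = L.+1 by lia.
rewrite EqL in E.
exists L; [split|]; lia.
Qed.

Lemma near_left L n x : n.*2 < M -> 0 < L -> 0 < x < L.+1 * M ->
  exists2 l, near L n l x & x <= l.+1 * M + n \/ l.+1 = L.
Proof.
move=> nM L0 /andP[x0 xL].
(* Reflect the word. *)
have [|l [lL /andP[l1 l2] l3 l4] l5] := @near_right L n (L.+1 * M - x) nM L0.
  by lia.
have [l' El] : exists l', L = l' + l.+1 by exists (L - l.+1); lia.
subst L.
by exists l'; [split|]; lia.
Qed.


Context (T : Type) (w : T -> seq nat) (K n0 : nat).
Context (Z : nat -> nat -> T -> T -> nat -> nat -> Prop).
Context (simZ : simulation lt_agree w K n0 Z).
Context (hM : n0.*2 < M) (w0 : forall c, 0 < size (w c)).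

Let lab k n c d i j (kK : k < K) (nn : n <= n0) (z : Z k n c d i j) :
  [/\ i < size (w c), j < size (w d) & forall a, nth a (w c) i = nth a (w d) j]
  := sim_label simZ kK nn z.

Let init k n c d i (kK : k < K) (nn : n <= n0) (si : i < size (w c)) :
  exists j, Z k n c d i j := sim_init simZ d kK nn si.

Let forth k n c d i j i' (kK : k < K) (nn : n < n0) (z : Z k n.+1 c d i j)
    (si : i' < size (w c)) : exists2 j', Z k n c d i' j' & lt_agree i i' j j'
  := sim_forth simZ kK nn z si.

(** Nearby letters are matched by [Z] and the offset from them is copied. Nearness in the second
    word is recovered only when the words are switched. *)
Definition pad_sim (k n : nat) (c d : T) (i j : nat) : Prop :=
  exists l l', [/\ Z k n c d l l', near (size (w c)) n l i.+1
    & i + l' * M = j + l * M].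

Lemma pad_sim_label k n c d i j : k < K -> n <= n0 -> pad_sim k n c d i j ->
  [/\ i < size (pad f p M (w c)), j < size (pad f p M (w d)) &
      forall a, nth a (pad f p M (w c)) i = nth a (pad f p M (w d)) j].
Proof.
move=> kK nn [l [l' [z [lc /andP[l1 l2] _ _] E]]].
have [_ l'd labl] := lab kK nn z.
have sz q L x : q < L -> x.+1 < q.+2 * M -> x < (L.+1 * M).-1.
  move=> qL; have : q.+2 * M <= L.+1 * M by rewrite leq_mul2r ltnS qL orbT.
  by lia.
have ic : i < size (pad f p M (w c)) by rewrite size_pad; apply: (sz l).
have jd : j < size (pad f p M (w d)) by rewrite size_pad; apply: (sz l') => //; lia.
have M0 : 0 < M by lia.
have key q x : q * M < x < q.+2 * M -> (M %| x) = (x == q.+1 * M).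
  move=> /andP[x1 x2]; apply/idP/eqP => [/dvdnP[t Et]|->]; last exact: dvdn_mull.
  rewrite Et in x1 x2 *; rewrite !ltn_mul2r in x1 x2.
  by congr (_ * _); lia.
have ki : (M %| i.+1) = (i.+1 == l.+1 * M) by apply: key; rewrite l1.
have kj : (M %| j.+1) = (j.+1 == l'.+1 * M) by apply: key; lia.
split=> // a; rewrite !nth_pad // {}ki {}kj.
have -> : (j.+1 == l'.+1 * M) = (i.+1 == l.+1 * M) by lia.
case: eqP => // Ei; have -> : j.+1 = l'.+1 * M by lia.
by rewrite Ei !mulnK //= labl.
Qed.

Lemma pad_sim_init k n c d i : k < K -> n <= n0 ->
  i < size (pad f p M (w c)) -> exists j, pad_sim k n c d i j.
Proof.
rewrite size_pad => kK nn si.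
have [||l nl _] := @near_right (size (w c)) n i.+1 _ (w0 c); try lia.
have [lL /andP[l1 _] _ _] := nl.
have [l' z] := init d kK nn lL.
by exists (i + l' * M - l * M), l, l'; split=> //; lia.
Qed.

Lemma pad_sim_drop k n c d i j : k.+1 < K -> n <= n0 ->
  pad_sim k.+1 n c d i j -> pad_sim k n d c j i.
Proof.
move=> kK nn [l [l' [z [lc /andP[l1 l2] l3 l4] E]]].
have z' := sim_drop simZ kK nn z.
have [_ l'd _] := lab kK nn z.
(* With no move left, the margins follow from the strict bounds. Otherwise one move detects the
   ends: if l' had a letter after (before) it, the reply would be one after (before) l. *)
exists l', l; split=> //; case: n nn z z' l3 l4 => [|n] nn z z' l3 l4.
  by split; lia.
have lst : l'.+1 < size (w d) -> l.+1 < size (w c).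
  move=> sl; have [l2' z2 ag] := forth (ltnW kK) nn z' sl.
  have [_ ? _] := lab (ltnW kK) (ltnW nn) z2.
  by case: ag; lia.
have fst : 0 < l' -> 0 < l.
  move=> sl; have [|l2' z2 ag] := forth (i' := 0) (ltnW kK) nn z'.
    by lia.
  by case: ag; lia.
split=> //; [by lia|case: l3|case: l4] => H; [left|right|left|right]; lia.
Qed.

Lemma pad_sim_forth k n c d i j i' : k < K -> n < n0 ->
  pad_sim k n.+1 c d i j -> i' < size (pad f p M (w c)) ->
  exists2 j', pad_sim k n c d i' j' & suc_agree i i' j j'.
Proof.
rewrite size_pad => kK nn [l [l' [z [lc /andP[o1 o2] o3 o4] E]]] si'.
have [_ l'd _] := lab kK nn z.
(* Keeping the letter l forces the reply l', so the distance is copied exactly. *)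
have stay : near (size (w c)) n l i'.+1 ->
    exists2 j', pad_sim k n c d i' j' & suc_agree i i' j j'.
  move=> nl; have [l2' z2 ag] := forth kK nn z lc.
  have El : l2' = l' by case: ag; lia.
  rewrite {}El in z2; have [_ /andP[? ?] _ _] := nl.
  exists (i' + l' * M - l * M); first by exists l, l'; split=> //; lia.
  by split; [split| |]; lia.
(* For a new letter only the order of the replies is known. The inequality keeps the copies at least
   2 apart even if the replies are adjacent letters, so they are never successors. *)
have step l2 : near (size (w c)) n l2 i'.+1 ->
    (i.+1 < i' /\ l < l2 /\ i.+2 + l2 * M <= i' + l.+1 * M) \/
    (i'.+1 < i /\ l2 < l /\ i'.+2 + l * M <= i + l2.+1 * M) ->
    exists2 j', pad_sim k n c d i' j' & suc_agree i i' j j'.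
  move=> nl H; have [l2c /andP[? ?] _ _] := nl.
  have [l2' z2 [ag1 ag2]] := forth kK nn z l2c.
  exists (i' + l2' * M - l2 * M); first by exists l2, l2'; split=> //; lia.
  case: H => [[ii' [ll H]]|[ii' [ll H]]].
    have : l'.+1 * M <= l2' * M by rewrite leq_mul2r -ag1 ll orbT.
    by move=> ?; split; [split| |]; lia.
  have : l2'.+1 * M <= l' * M by rewrite leq_mul2r -ag2 ll orbT.
  by move=> ?; split; [split| |]; lia.
case: (leqP i.+2 i') => [ii'|ii'].
  case: (ltnP (i'.+1 + n) (l.+2 * M)) => [?|far].
    by apply: stay; split=> //; lia.
  case: (l.+1 =P size (w c)) => [El|nl].
    by apply: stay; split=> //; nia.
  have [||l2 nl2 H] := @near_right (size (w c)) n i'.+1 _ (w0 c); try lia.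
  have ll : l < l2.
    have [_ /andP[_ ?] l23 _] := nl2; rewrite ltnNge; apply/negP => l2l.
    have : l2 * M <= l * M by rewrite leq_mul2r l2l orbT.
    by lia.
  by apply: (step l2) => //; lia.
case: (leqP i'.+2 i) => [i'i|i'i].
  case: (ltnP (l * M + n) i'.+1) => [?|far].
    by apply: stay; split=> //; lia.
  case: (l =P 0) => [El|nl].
    by apply: stay; split=> //; lia.
  have [||l2 nl2 H] := @near_left (size (w c)) n i'.+1 _ (w0 c); try lia.
  have ll : l2 < l.
    have [_ /andP[? _] _ l24] := nl2; rewrite ltnNge; apply/negP => l2l.
    have : l * M <= l2 * M by rewrite leq_mul2r l2l orbT.
    by lia.
  by apply: (step l2) => //; lia.
(* A move by at most one costs at most one unit of margin, paid by passing from n + 1 to n. *)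
apply: stay; split=> //; nia.
Qed.

Lemma pad_simulation :
  simulation suc_agree (fun c => pad f p M (w c)) K n0 pad_sim.
Proof.
split; [exact: pad_sim_label|exact: pad_sim_init|exact: pad_sim_forth|].
exact: pad_sim_drop.
Qed.

End Padding.

(** * Onions *)

(** The letter s stands at the end facing the core: odd layers lie on the right and begin with s,
    even ones lie on the left and end with s. *)
Definition block (s : nat) : seq nat :=
  if odd s then s :: iota 0 s else rcons (iota 0 s) s.

Definition shell (N s : nat) : seq nat := flatten (nseq N (block s)).

Fixpoint onion (N c s : nat) : seq nat :=
  match s with
  | 0 => nseq c 0
  | t.+1 => if odd t.+1 then onion N c t ++ shell N t.+1
            else shell N t.+1 ++ onion N c t
  end.

Fixpoint left_peel (N s d : nat) : seq nat :=
  if d is d'.+1 then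
    left_peel N s.+1 d' ++ (if odd s.+1 then [::] else shell N s.+1)
  else [::].

Fixpoint right_peel (N s d : nat) : seq nat :=
  if d is d'.+1 then
    (if odd s.+1 then shell N s.+1 else [::]) ++ right_peel N s.+1 d'
  else [::].

Lemma size_block s : size (block s) = s.+1.
Proof. by rewrite /block; case: ifP; rewrite /= ?size_rcons size_iota. Qed.

Lemma mem_block s a : (a \in block s) = (a <= s).
Proof.
by rewrite /block; case: ifP; rewrite ?mem_rcons inE mem_iota; lia.
Qed.

Lemma size_shell N s : size (shell N s) = N * s.+1.
Proof.
elim: N => // N IH; rewrite /shell /= size_cat size_block.
by rewrite -[flatten _]/(shell N s) IH mulSn.
Qed.

Lemma nth_shell N s k r : k < N -> r <= s ->
  nth 0 (shell N s) (k * s.+1 + r) = nth 0 (block s) r.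
Proof.
elim: N k => // N IH k kN rs; rewrite /shell /= nth_cat size_block.
rewrite -[flatten _]/(shell N s).
case: k kN => [|k] kN; first by rewrite mul0n add0n ltnS rs.
have -> : (k.+1 * s.+1 + r < s.+1) = false by lia.
have -> : k.+1 * s.+1 + r - s.+1 = k * s.+1 + r by lia.
exact: IH.
Qed.

Lemma mem_shell N s a : a \in shell N s -> a <= s.
Proof.
elim: N => // N IH; rewrite /shell /= mem_cat mem_block => /orP[//|].
exact: IH.
Qed.

Lemma size_onion N c s : size (onion N c s) = c + size (onion N 0 s).
Proof.
elim: s => [|s IH] /=; first by rewrite !size_nseq addn0.
by case: ifP => _; rewrite !size_cat IH; lia.
Qed.

Lemma mem_onion N c s a : a \in onion N c s -> a <= s.
Proof.
elim: s => [|s IH] /=; first by rewrite mem_nseq => /andP[_ /eqP->].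
by case: ifP => _; rewrite mem_cat => /orP[];
  first [by move/mem_shell | by move/IH/leqW].
Qed.

Lemma onion_peel N c s d :
  onion N c (s + d) = left_peel N s d ++ onion N c s ++ right_peel N s d.
Proof.
elim: d s => [|d IH] s; first by rewrite addn0 /= cats0.
rewrite addnS -addSn IH /=.
by case: ifP => _; rewrite /= ?cats0 -?catA.
Qed.

Section Onion.
Context (S N : nat).

Definition lo (s : nat) : nat := size (left_peel N s (S - s)).

(* The layers up to s occupy the positions from [lo s] to [c + hi s] in the
   onion with a core of size c. *)
Definition hi (s : nat) : nat := lo s + size (onion N 0 s).

Local Notation letter c := (nth 0 (onion N c S)).

Lemma loS s : s < S ->
  lo s = if odd s then lo s.+1 + N * s.+2 else lo s.+1.
Proof.
move=> sS; rewrite /lo; have -> : S - s = (S - s.+1).+1 by lia.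
rewrite /= size_cat; case: (odd s) => /=; rewrite ?size_shell //; lia.
Qed.

Lemma hiS s : s < S -> hi s.+1 = if odd s then hi s else hi s + N * s.+2.
Proof.
move=> sS; rewrite /hi (loS sS) /=.
by case: (odd s); rewrite /= size_cat size_shell; lia.
Qed.

Lemma lo_hi0 : hi 0 = lo 0.
Proof. by rewrite /hi /= addn0. Qed.

Lemma size_onion_hi c : size (onion N c S) = c + hi S.
Proof. by rewrite /hi /lo subnn size_onion. Qed.

Lemma lo_mono s t : s <= t -> t <= S -> lo t <= lo s.
Proof.
move=> st; rewrite -(subnKC st); elim: (t - s) => [|d IH]; first by rewrite addn0.
rewrite addnS => dS; apply: leq_trans (IH (ltnW dS)).
by rewrite (loS dS); case: ifP => _; lia.
Qed.

Lemma hi_mono s t : s <= t -> t <= S -> hi s <= hi t.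
Proof.
move=> st; rewrite -(subnKC st); elim: (t - s) => [|d IH]; first by rewrite addn0.
rewrite addnS => dS; apply: (leq_trans (IH (ltnW dS))).
by rewrite (hiS dS); case: ifP => _; lia.
Qed.

Lemma nth_onion c s p : s <= S -> p < size (onion N c s) ->
  letter c (lo s + p) = nth 0 (onion N c s) p.
Proof.
move=> sS ps; rewrite -{1}(subnKC sS) onion_peel -/(lo s).
by rewrite nth_cat ltnNge leq_addr addKn nth_cat ps.
Qed.

Lemma letter_le c s p : s <= S -> lo s <= p < c + hi s -> letter c p <= s.
Proof.
move=> sS /andP[p1 p2]; rewrite -(subnKC p1).
have ps : p - lo s < size (onion N c s) by rewrite size_onion; rewrite /hi in p2; lia.
by rewrite nth_onion //; apply/(@mem_onion N c)/mem_nth.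
Qed.

Lemma letter_left c d p : p < lo 0 -> letter c p = letter d p.
Proof.
by move=> p0; rewrite -(add0n S) !onion_peel !nth_cat -(subn0 S) -/(lo 0) p0.
Qed.

Lemma letter_right c d p q : p + d = q + c -> c + hi 0 <= p ->
  letter c p = letter d q.
Proof.
rewrite lo_hi0 => E p0; rewrite -(add0n S) !onion_peel !nth_cat -(subn0 S) -/(lo 0).
have -> : (p < lo 0) = false by lia.
have -> : (q < lo 0) = false by lia.
rewrite !size_nseq.
have -> : (p - lo 0 < c) = false by lia.
have -> : (q - lo 0 < d) = false by lia.
by congr nth; lia.
Qed.

(** Right-hand layers lie beyond the core, whence their shift by [c]. *)
Definition shell_start (c s : nat) : nat :=
  if odd s then c + hi s.-1 else lo s.

Lemma letter_shell c s k r : 0 < s <= S -> k < N -> r <= s ->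
  letter c (shell_start c s + (k * s.+1 + r)) = nth 0 (block s) r.
Proof.
case: s => // s /= sS kN rs.
have kr : k * s.+2 + r < N * s.+2.
  have : k.+1 * s.+2 <= N * s.+2 by rewrite leq_mul2r kN orbT.
  by lia.
rewrite /shell_start -(nth_shell kN rs).
have := @nth_onion c s.+1; have sz := size_onion N c s.
have lS := loS sS; rewrite /hi /=; case: (odd s) lS => /= lS H.
  rewrite H // ?size_cat ?size_shell; last by lia.
  by rewrite nth_cat size_shell kr.
have -> : c + (lo s + size (onion N 0 s)) + (k * s.+2 + r)
          = lo s.+1 + (size (onion N c s) + (k * s.+2 + r)) by lia.
rewrite H // ?size_cat ?size_shell; last by lia.
by rewrite nth_cat ltnNge leq_addr addKn.
Qed.

Lemma shell_letter c s k a : 0 < s <= S -> k < N -> a <= s ->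
  exists2 q, shell_start c s + k * s.+1 <= q < shell_start c s + k.+1 * s.+1
    & letter c q = a.
Proof.
move=> sS kN as_; pose r := index a (block s).
have rs : r <= s by rewrite -ltnS -(size_block s) index_mem mem_block.
exists (shell_start c s + (k * s.+1 + r)); first by lia.
by rewrite letter_shell // nth_index // mem_block.
Qed.

(** The layer t + 1 moves only one end of the interval, the left one exactly when t is odd. These
    facts reduce later position arguments to arithmetic. *)
Lemma onion_geometry t : t < S ->
  [/\ lo t <= lo 0, lo 0 = hi 0, hi 0 <= hi t, hi t.+1 <= hi S &
   if odd t then
     [/\ lo t = lo t.+1 + N * t.+2, hi t.+1 = hi t &
         forall c, shell_start c t.+1 = lo t.+1]
   else
     [/\ lo t = lo t.+1, hi t.+1 = hi t + N * t.+2 &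
         forall c, shell_start c t.+1 = c + hi t]].
Proof.
move=> tS; split; rewrite ?lo_hi0 //.
- exact: lo_mono (ltnW tS).
- by rewrite -lo_hi0; apply: hi_mono (ltnW tS).
- exact: hi_mono.
by have := loS tS; have := hiS tS; rewrite /shell_start /=; case: (odd t).
Qed.

(** * Zones around the core, and copying outside them *)

(* [inner c s n] are the layers up to s without the n outermost blocks of the
   layer s; [middle c s n] is the layer s without n blocks at either end. *)
Definition inner_lo (s n : nat) := lo s + (if odd s then 0 else n * s.+1).
Definition inner_hi (s n : nat) := hi s - (if odd s then n * s.+1 else 0).

Definition inner (c s n p : nat) : bool :=
  inner_lo s n <= p < c + inner_hi s n.

Definition middle (c s n p : nat) : bool :=
  shell_start c s + n * s.+1 <= p < shell_start c s + (N - n) * s.+1.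

(** Outside the inner zone positions are copied, literally on its left and shifted by the difference
    of the core sizes on its right. *)
Definition aligned (s n c d p q : nat) : Prop :=
  (p = q /\ p < inner_lo s n) \/
  [/\ p + d = q + c, c + inner_hi s n <= p & p < c + hi S].

Context (n0 : nat) (hN : n0.*2 + 3 <= N).

Lemma inner_bounds s n : 0 < s <= S -> n <= n0.+1 ->
  [/\ inner_lo s n <= lo 0, lo 0 = hi 0, hi 0 <= inner_hi s n &
      inner_hi s n <= hi S].
Proof.
case: s => // t tS nn; have [] := onion_geometry tS.
rewrite /inner_lo /inner_hi /=.
have : n * t.+2 <= N * t.+2 by rewrite leq_mul2r; lia.
by case: (odd t) => /= ? ? ? ? ? [? ? _]; split; lia.
Qed.

Lemma inner_mono c s n p : inner c s n.+1 p -> inner c s n p.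
Proof.
rewrite /inner /inner_lo /inner_hi.
by case: (odd s); lia.
Qed.

Lemma inner_succ c s n p : 0 < s < S -> n <= n0 -> inner c s n p ->
  inner c s.+1 n p.
Proof.
case: s => // t /= tS nn.
have [] := onion_geometry tS; have [] := onion_geometry (ltnW tS).
rewrite /inner /inner_lo /inner_hi /= negbK.
have : n * t.+3 <= N * t.+3 by rewrite leq_mul2r; lia.
by case: (odd t) => /= ? ? ? ? ? [? ? _] ? ? ? ? [? ? _]; lia.
Qed.

Lemma middle_mono c s n p : middle c s n.+1 p -> middle c s n p.
Proof.
rewrite /middle => /andP[A B]; apply/andP; split; first by lia.
by apply: (leq_trans B); rewrite leq_add2l leq_mul2r; lia.
Qed.

Lemma middle_inner c s n p : 0 < s <= S -> n <= n0 -> middle c s n p ->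
  inner c s n p.
Proof.
case: s => // t tS nn; have [] := onion_geometry tS.
rewrite /middle /inner /inner_lo /inner_hi /= mulnBl.
have : n * t.+2 <= N * t.+2 by rewrite leq_mul2r; lia.
by case: (odd t) => /= ? ? ? ? ? [? ? ->]; lia.
Qed.

Lemma inner_letter c s n p : s <= S -> inner c s n p ->
  nth 0 (onion N c S) p <= s.
Proof.
move=> sS ip; apply: (letter_le (c := c)) => //; move: ip.
by rewrite /inner /inner_lo /inner_hi; case: (odd s); lia.
Qed.

Lemma aligned_letter s n c d p q : 0 < s <= S -> n <= n0.+1 ->
  aligned s n c d p q -> letter c p = letter d q.
Proof.
move=> sS nn; have [b1 b2 b3 b4] := inner_bounds sS nn.
case=> [[<- p1]|[E p1 p2]]; first by apply: letter_left; lia.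
by apply: letter_right => //; lia.
Qed.

Lemma aligned_size s n c d p q : 0 < s <= S -> n <= n0.+1 ->
  aligned s n c d p q -> p < c + hi S /\ q < d + hi S.
Proof.
move=> sS nn; have [b1 b2 b3 b4] := inner_bounds sS nn.
by case=> [[<- p1]|[E p1 p2]]; lia.
Qed.

Lemma aligned_exists s n c d p : 0 < s <= S -> n <= n0.+1 -> p < c + hi S ->
  ~~ inner c s n p -> exists q, aligned s n c d p q.
Proof.
move=> sS nn ps; rewrite /inner negb_and -ltnNge -leqNgt => /orP[p1|p1].
  by exists p; left.
by exists (p + d - c); right; split=> //; lia.
Qed.

(** The inner zones have the same left end, and their right ends differ by the shift of the
    copies. *)
Lemma aligned_agree s n c d p q p' q' : 0 < s <= S -> n <= n0.+1 ->
  aligned s n c d p q ->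
  aligned s n c d p' q' \/ (inner c s n p' /\ inner d s n q') ->
  lt_agree p p' q q' /\ lt_agree p' p q' q.
Proof.
move=> sS nn; have [b1 b2 b3 b4] := inner_bounds sS nn.
rewrite /aligned /inner /lt_agree.
by case=> [[<- p1]|[E p1 p2]] [[[<- p1']|[E' p1' p2']]|[H1 H2]]; lia.
Qed.

Lemma aligned_sym s n c d p q :
  aligned s n c d p q -> aligned s n d c q p.
Proof. by case=> [[<- p1]|[E p1 p2]]; [left | right; split; lia]. Qed.

(** A copied pair lies on one side of the core, and there the other zone ends at corresponding
    places in both words; it contains both positions or neither. *)
Lemma aligned_change s n s' n' c d p q :
  0 < s <= S -> n <= n0.+1 -> 0 < s' <= S -> n' <= n0.+1 ->
  aligned s n c d p q ->
  aligned s' n' c d p q \/ (inner c s' n' p /\ inner d s' n' q).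
Proof.
move=> sS nn sS' nn'; have [b1 b2 b3 b4] := inner_bounds sS nn.
have [c1 c2 c3 c4] := inner_bounds sS' nn'.
rewrite /aligned /inner.
case=> [[<- p1]|[E p1 p2]].
  by case: (ltnP p (inner_lo s' n')) => ?; [left; left | right; lia].
case: (leqP (c + inner_hi s' n') p) => ?; first by left; right.
by right; lia.
Qed.

Lemma aligned_pred s n c d p q : 0 < s < S -> n <= n0 ->
  aligned s.+1 n c d p q -> aligned s n c d p q.
Proof.
case: s => // t /= tS nn.
have [] := onion_geometry tS; have [] := onion_geometry (ltnW tS).
rewrite /aligned /inner_lo /inner_hi /= negbK.
have : n * t.+3 <= N * t.+3 by rewrite leq_mul2r; lia.
case: (odd t) => /= ? ? ? ? ? [? ? _] ? ? ? ? [? ? _];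
 (case=> [[? ?]|[? ? ?]]; [left|right]; split=> //; lia).
Qed.

(** * The replies of the duplicator on onions *)

Lemma middle_letter d s n k a : 0 < s <= S -> n <= k < N - n -> a <= s ->
  exists q, [/\ letter d q = a, middle d s n q &
    shell_start d s + k * s.+1 <= q < shell_start d s + k.+1 * s.+1].
Proof.
move=> sS /andP[k1 k2] as_.
have [|q /andP[q1 q2] <-] := @shell_letter d s k a sS _ as_; first by lia.
exists q; split=> //; last by rewrite q1.
rewrite /middle; apply/andP; split.
  by apply: leq_trans q1; rewrite leq_add2l leq_mul2r k1 orbT.
by apply: (leq_trans q2); rewrite leq_add2l leq_mul2r k2 orbT.
Qed.

Lemma middle_reply c d s n p q p' : 0 < s <= S -> n < n0 ->
  letter c p = letter d q -> inner c s n.+1 p -> middle d s n.+1 q ->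
  p' < c + hi S ->
  exists2 q', aligned s n c d p' q' \/
      [/\ letter c p' = letter d q', inner c s n p' & middle d s n q']
    & lt_agree p p' q q'.
Proof.
move=> sS nn lpq ip mq ps.
case: (boolP (inner c s n p')) => [ip'|op'].
  have lp' : letter c p' <= s by apply: inner_letter ip'; case/andP: sS.
  move: mq; rewrite /middle => /andP[q1 q2].
  (* The blocks n and N - n - 1 are in the middle for n but not for n + 1, so they lie on either
     side of q and still offer every letter up to s. *)
  case: (ltngtP p' p) => [pp|pp|->].
  - have [|q' [l1 l2 /andP[_ l3]]] := @middle_letter d s n n _ sS _ lp'; first by lia.
    by exists q'; [right | split; lia].
  - have [|q' [l1 l2 /andP[l3 _]]] := @middle_letter d s n (N - n.+1) _ sS _ lp'.
      by lia.
    by exists q'; [right | split; lia].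
  - exists q; last by split; rewrite !ltnn.
    by right; split=> //; apply: middle_mono; rewrite /middle q1.
have [q' al] := aligned_exists d sS (leqW (ltnW nn)) ps op'.
exists q'; first by left.
have ii : inner c s n p /\ inner d s n q.
  split; first exact: inner_mono.
  by apply: middle_inner (ltnW nn) _ => //; apply: middle_mono.
by have [_ ?] := aligned_agree sS (leqW (ltnW nn)) al (or_intror ii).
Qed.

(* The winning invariant when the spoiler may still switch words [S - s] times
   and move [n] times. A position in the middle of the layer s offers every
   letter up to s on both sides, which beats any inner position as long as the
   spoiler does not switch; a switch turns any pair of inner positions for s
   into the third case for s + 1. *)
Definition onion_rel (s n c d p q : nat) : Prop :=
  [\/ aligned (maxn 1 s.-1) n c d p q,
      [/\ letter c p = letter d q, inner c s n p & middle d s n q]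
    | [/\ 1 < s, letter c p = letter d q, inner c s.-1 n p & inner d s.-1 n q]].

(** The bare core has no blocks to reply in, so the zone reaches at least layer 1. A reply in the
    middle of its last layer gives the second case for s = 1 and the third otherwise. *)
Lemma inner_reply s n c d p : 0 < s <= S -> n <= n0 ->
  inner c (maxn 1 s.-1) n p ->
  exists2 q, onion_rel s n c d p q & inner d (maxn 1 s.-1) n q.
Proof.
move=> sS nn ip; have tS : 0 < maxn 1 s.-1 <= S by lia.
have lp : letter c p <= maxn 1 s.-1 by apply: inner_letter ip; case/andP: tS.
have [|q [l1 l2 _]] := @middle_letter d (maxn 1 s.-1) n n _ tS _ lp; first by lia.
have iq := middle_inner tS nn l2.
exists q => //; case: (leqP s 1) => s1.
  have E : maxn 1 s.-1 = s by lia.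
  by rewrite E in ip l2; constructor 2.
have E : maxn 1 s.-1 = s.-1 by lia.
by rewrite E in ip iq; constructor 3.
Qed.

Lemma outer_reply s n c d p q : 0 < s <= S -> n < n0 ->
  aligned (maxn 1 s.-1) n.+1 c d p q -> onion_rel s n c d p q.
Proof.
move=> sS nn al; have tS : 0 < maxn 1 s.-1 <= S by lia.
have lpq := aligned_letter tS (leqW nn) al.
have [al'|[ip iq]] := aligned_change tS (leqW nn) tS (leqW (ltnW nn)) al; first by constructor 1.
case: (leqP s 1) => s1; last first.
  have E : maxn 1 s.-1 = s.-1 by lia.
  by rewrite E in ip iq; constructor 3.
(* The pair is outside the zone for n + 1 but inside that for n, so it lies in block N - n - 1 of
   layer 1, a middle block for n. *)
have Es : s = 1 by lia.
rewrite Es -[maxn 1 1.-1]/1 in al ip iq *; constructor 2; split=> //.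
have [] := @onion_geometry 0; first by lia.
move: al ip iq; rewrite /aligned /inner /middle /inner_lo /inner_hi /=.
by move=> al ip iq ? ? ? ? [E1 E2 ->]; case: al => [[? ?]|[? ? ?]]; lia.
Qed.

(** On the side of layer s - 1, one more of its blocks becomes available as n + 1 drops to n, which
    keeps the third case. On the other side, layer s lies entirely beyond q and its middle gives the
    second case. *)
Lemma inner_move s n c d p q p' : 1 < s <= S -> n < n0 ->
  letter c p = letter d q -> inner c s.-1 n.+1 p -> inner d s.-1 n.+1 q ->
  inner c s.-1 n.+1 p' ->
  exists2 q', onion_rel s n c d p' q' & lt_agree p p' q q'.
Proof.
case: s => [|[|t]] //= tS nn lpq ip iq ip'.
have lp' : letter c p' <= t.+1 by apply: inner_letter ip'; lia.
have ip'n := inner_mono ip'.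
case: (p' =P p) => [->|pp].
  exists q; last by split; rewrite !ltnn.
  by constructor 3; split=> //; apply: inner_mono.
have outward k : k < N ->
    (if odd t then k = n else k = N - n.+1) ->
    exists q', [/\ letter d q' = letter c p', inner d t.+1 n q' &
      if odd t then q' < q else q < q'].
  move=> kN Ek; have [||q' [l1 l2 l3]] := @middle_letter d t.+1 n k _ _ _ lp'.
  - by lia.
  - by case: (odd t) Ek; lia.
  exists q'; split=> //; first by apply: middle_inner l2; lia.
  have [] := @onion_geometry t; first by lia.
  move: iq l3; rewrite /inner /inner_lo /inner_hi /=.
  have EN : N - n.+1 + n.+1 = N by lia.
  case: (odd t) Ek => /= -> iq l3 _ _ _ _ [E1 E2 E3]; rewrite E3 in l3; first by lia.
  rewrite mulSn in l3.
  have : (N - n.+1) * t.+2 + n.+1 * t.+2 = N * t.+2 by rewrite -mulnDl EN.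
  by move: ((N - n.+1) * t.+2) l3 => x; lia.
have inward : exists q', [/\ letter d q' = letter c p', middle d t.+2 n q' &
      if odd t then q < q' else q' < q].
  have [||q' [l1 l2 l3]] := @middle_letter d t.+2 n n.+1 _ _ _ (leqW lp').
  - by lia.
  - by lia.
  exists q'; split=> //.
  have [] := @onion_geometry t; first by lia.
  have [] := @onion_geometry t.+1; first by lia.
  have : n.+2 * t.+3 <= N * t.+3 by rewrite leq_mul2r; lia.
  move: iq l3; rewrite /inner /inner_lo /inner_hi /=.
  by case: (odd t) => /= iq l3 ? _ _ _ _ [E1 E2 E3] _ _ _ _ [F1 F2 F3];
    rewrite E3 in l3; lia.
have [q1 [o1 o2 o3]] : exists q', [/\ letter d q' = letter c p',
    inner d t.+1 n q' & if odd t then q' < q else q < q'].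
  by case: (odd t) outward => H; [apply: (H n) | apply: (H (N - n.+1))]; lia.
have [q2 [i1 i2 i3]] := inward.
have ip2 : inner c t.+2 n p' by apply: inner_succ ip'n; lia.
case: (odd t) o3 i3 => o3 i3; case: (ltnP p' p) => pp'.
- by exists q1; [constructor 3 | split; lia].
- by exists q2; [constructor 2 | split; lia].
- by exists q2; [constructor 2 | split; lia].
- by exists q1; [constructor 3 | split; lia].
Qed.

Lemma onion_forth s n c d p q p' : 0 < s <= S -> n < n0 ->
  onion_rel s n.+1 c d p q -> p' < c + hi S ->
  exists2 q', onion_rel s n c d p' q' & lt_agree p p' q q'.
Proof.
move=> sS nn; have tS : 0 < maxn 1 s.-1 <= S by lia.
have n1 : n.+1 <= n0.+1 by lia.
case=> [al|[lpq ip mq]|[s1 lpq ip iq]] ps.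
- case: (boolP (inner c (maxn 1 s.-1) n.+1 p')) => [ip'|op'].
    (* The reply is found at n + 1, where the order can be read off the zones, and then weakened to
       n. *)
    have [q' H iq'] := inner_reply d sS nn ip'.
    exists q'; last first.
      by have [] := aligned_agree tS n1 al (or_intror (conj ip' iq')).
    case: H => [al'|[? ? ?]|[? ? ? ?]].
    + exact: outer_reply.
    + by constructor 2; split=> //; [apply: inner_mono|apply: middle_mono].
    + by constructor 3; split=> //; apply: inner_mono.
  have [q' al'] := aligned_exists d tS n1 ps op'.
  exists q'; first exact: outer_reply.
  by have [] := aligned_agree tS n1 al (or_introl al').
- have [q' H ag] := middle_reply sS nn lpq ip mq ps.
  exists q' => //; case: H => [al|H]; last by constructor 2.
  constructor 1; case: (leqP s 1) => s1; first by have -> : maxn 1 s.-1 = s by lia.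
  case: s sS tS s1 al {lpq ip mq ag} => // s sS tS s1 al.
  have -> : maxn 1 s.+1.-1 = s by lia.
  by apply: aligned_pred al; lia.
- have E : maxn 1 s.-1 = s.-1 by lia.
  case: (boolP (inner c s.-1 n.+1 p')) => [ip'|op'].
    by apply: (inner_move _ nn lpq ip iq ip'); lia.
  rewrite E in tS; have [q' al'] := aligned_exists d tS n1 ps op'.
  exists q'; first by apply: outer_reply; rewrite ?E.
  by have [] := aligned_agree tS n1 al' (or_intror (conj ip iq)).
Qed.

Lemma onion_drop s n c d p q : 0 < s < S -> n <= n0 ->
  onion_rel s n c d p q -> onion_rel s.+1 n d c q p.
Proof.
move=> sS nn; have tS : 0 < maxn 1 s.-1 <= S by lia.
have sS' : 0 < s <= S by lia.
have Es : maxn 1 s.+1.-1 = s by lia.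
have sub c' p' : inner c' s.-1 n p' -> 1 < s -> inner c' s n p'.
  by case: s sS {tS Es sS'} => // s sS; move=> ? ?; apply: inner_succ => //; lia.
case=> [al|[lpq ip mq]|[s1 lpq ip iq]]; last 2 first.
- by constructor 3; split=> //; [lia|exact: middle_inner].
- by constructor 3; split; rewrite //=; [lia| exact: sub | exact: sub].
have lpq := aligned_letter tS (leqW nn) al.
have [al'|[ip iq]] := aligned_change tS (leqW nn) sS' (leqW nn) al.
  by constructor 1; rewrite Es; apply: aligned_sym.
by constructor 3; split=> //; lia.
Qed.

Lemma onion_simulation :
  simulation lt_agree (fun c => onion N c S) S n0 (fun k => onion_rel (S - k)).
Proof.
split.
- move=> k n c d p q kS nn; rewrite !size_onion_hi.
  have sS : 0 < S - k <= S by lia.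
  move: (S - k) sS => s sS H; have tS : 0 < maxn 1 s.-1 <= S by lia.
  have nn1 := leqW nn.
  have fin c' s' p' : 0 < s' <= S -> inner c' s' n p' -> p' < c' + hi S.
    by move=> s'S; have [] := inner_bounds s'S nn1; rewrite /inner; lia.
  have [E [ps qs]] : letter c p = letter d q /\ p < c + hi S /\ q < d + hi S.
    case: H => [al|[lpq ip mq]|[s1 lpq ip iq]].
    + by split; [apply: aligned_letter al | apply: aligned_size al].
    + by do !split => //; apply: (fin _ s) => //; apply: middle_inner.
    + by do !split => //; apply: (fin _ s.-1) => //; lia.
  by split=> // a; rewrite (set_nth_default 0) ?size_onion_hi // E
    (set_nth_default 0) ?size_onion_hi.
- move=> k n c d p kS nn; rewrite size_onion_hi => ps.
  have sS : 0 < S - k <= S by lia.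
  move: (S - k) sS => s sS; have tS : 0 < maxn 1 s.-1 <= S by lia.
  case: (boolP (inner c (maxn 1 s.-1) n p)) => [ip|op].
    by have [q H _] := inner_reply d sS nn ip; exists q.
  by have [q al] := aligned_exists d tS (leqW nn) ps op; exists q; constructor 1.
- move=> k n c d p q p' kS nn H; rewrite size_onion_hi => ps.
  by apply: onion_forth H ps => //; lia.
- move=> k n c d p q kS nn H; have -> : S - k = (S - k.+1).+1 by lia.
  by apply: onion_drop H => //; lia.
Qed.

End Onion.

(** * Isolating the core *)

(** The layers up to t lack the letter t + 1, while layer t + 1 carries it at the end facing them;
    the cut removes exactly that layer. *)
Lemma peel_step S N c t l : 0 < N -> t < S ->
  lo S N t <= l < c + hi S N t <->
  lo S N t.+1 <= l < c + hi S N t.+1 /\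
  forall l', l' < size (onion N c S) -> nth 0 (onion N c S) l' = t.+1 ->
    (if odd t.+1 then l < l' else l' < l) \/
    ~ (lo S N t.+1 <= l' < c + hi S N t.+1).
Proof.
move=> N0 tS; have le := @letter_le S N c t _ (ltnW tS).
rewrite size_onion_hi; have [h1 h2 h3 hS] := onion_geometry N tS.
have := @letter_shell S N c t.+1 0 0 tS N0 (leq0n _).
have Nm : N.-1 < N by lia.
have := @letter_shell S N c t.+1 N.-1 t.+1 tS Nm (leqnn _).
have NN : N.-1 * t.+2 + t.+2 = N * t.+2 by rewrite -mulSnr prednK.
move: (N.-1 * t.+2) NN => x NN.
rewrite /block /=; case: (odd t) => /= A B [E1 E2 E3]; rewrite E3 in A B.
- move: A {B}; rewrite nth_rcons size_iota ltnn eqxx => A; split=> [H|[H D]].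
    split=> [|l' _ El']; first by lia.
    case: (ltnP l' l) => ll; [by left|right=> Dl'].
    by have := le l'; rewrite El'; lia.
  by case: (D _ _ A); lia.
- move: B {A}; rewrite mul0n !addn0 => B; split=> [H|[H D]].
    split=> [|l' _ El']; first by lia.
    case: (ltnP l l') => ll; [by left|right=> Dl'].
    by have := le l'; rewrite El'; lia.
  by case: (D _ _ B); lia.
Qed.

Definition other (v : var) : var := if v is VX then VY else VX.

(* With [b = true] the formula says that [v] survives the first [d] cuts, the
   cut by the letter t = S, S - 1, ... keeping what lies before the first t
   (t odd) or after the last t (t even) of what is left; with [b = false] it is
   the negation. *)
Fixpoint survives (Sigma : Type) (f : nat -> Sigma) (S : nat) (b : bool)
    (d : nat) (v : var) : form Sigma :=
  if d is e.+1 then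
    let t := S - e in let u := other v in
    let: (x, y) := if odd t then (v, u) else (u, v) in
    if b then
      FAnd (survives f S true e v)
           (FAll u (FOr (FNLetter (f t) u)
                        (FOr (FLt Sigma x y) (survives f S false e u))))
    else
      FOr (survives f S false e v)
          (FEx u (FAnd (FLetter (f t) u)
                       (FAnd (FNLt Sigma x y) (survives f S true e u))))
  else if b then FTrue else FFalse.

Definition core_formula (Sigma : Type) (f : nat -> Sigma) (S : nat) :
    form Sigma :=
  FEx VX (FAnd (FLetter (f 0) VX) (survives f S true S VX)).

Lemma blocks_survives (Sigma : Type) (f : nat -> Sigma) S b d v q :
  blocks q (survives f S b d v) <= d.
Proof.
elim: d b v q => [|d IH] b v q /=; first by case: b.
case: (odd _); case: b => /=; rewrite geq_max ?max0n;
  apply/andP; split; rewrite ?(leqW (IH _ _ _)) //;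
  case: ifP => _; rewrite ?add0n ?add1n ?(leqW (IH _ _ _)) //; exact: IH.
Qed.

Lemma free_survives (Sigma : Type) (f : nat -> Sigma) S b d v :
  free (other v) (survives f S b d v) = false.
Proof.
elim: d b => [|d IH] b /=; first by case: b.
by case: (odd _); case: b; rewrite /= IH; case: v {IH}.
Qed.

Section Semantics.
Context (Sigma : eqType) (f : nat -> Sigma) (p : Sigma) (M N S c : nat).
Context (M0 : 0 < M) (N0 : 0 < N) (fp : forall a, a <= S -> f a <> p)
  (fI : forall a b, a <= S -> b <= S -> f a = f b -> a = b).

Local Notation w := (onion N c S).

Lemma letter_pad t i : t <= S ->
  (i < size (pad f p M w) /\ nth (f t) (pad f p M w) i = f t) <->
  exists l, [/\ l < size w, i = (l.+1 * M).-1 & nth 0 w l = t].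
Proof.
move=> tS; split=> [[si]|[l [lw -> lt]]].
  rewrite nth_pad // ; rewrite size_pad in si.
  case: ifP => [/dvdnP[[|l] E] H|_ H]; [by lia| |by case: (fp tS)].
  have lw : l < size w by rewrite -ltnS -(ltn_pmul2r M0) -E; lia.
  rewrite E mulnK //= in H; exists l; split=> //; first by lia.
  by apply: fI H => //; apply/(@mem_onion N c)/mem_nth.
have pos : (l.+1 * M).-1.+1 = l.+1 * M by lia.
have si : (l.+1 * M).-1 < size (pad f p M w).
  rewrite size_pad; have : l.+2 * M <= (size w).+1 * M by rewrite leq_pmul2r.
  by lia.
by split=> //; rewrite nth_pad // pos dvdn_mull // mulnK //= lt.
Qed.

(** Formulas negate only atoms, so the negation is a formula of its own; the quantifier duality is
    classical. *)
Lemma sat_survives_neg u s d v :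
  sat u s (survives f S false d v) <-> ~ sat u s (survives f S true d v).
Proof.
elim: d v s => [|d IH] v s /=; first by split=> // H; case: H.
case: (odd _); rewrite /= IH.
all: split=> [[H1|[i [iu [H1 [H2 H3]]]]] [H4 H5]|H] //.
all: try by case: (H5 i iu) => [|[|/IH]].
all: case: (classic (sat u s (survives f S true d v))) => [H1|]; last by left.
all: right; apply: NNPP => H2; apply: H; split=> // i iu.
all: apply: NNPP => H3; apply: H2; exists i; rewrite IH in H3.
all: by split=> //; do !split; apply: NNPP; tauto.
Qed.

(** Each cut is an instance of [peel_step]: an occurrence of t matters only if it survived the
    previous cuts, hence the recursive call on the other variable. *)
Lemma sat_survives d v l (s : var -> nat) : d <= S -> l < size w ->
  s v = (l.+1 * M).-1 ->
  sat (pad f p M w) s (survives f S true d v) <->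
  lo S N (S - d) <= l < c + hi S N (S - d).
Proof.
elim: d v l s => [|d IH] v l s dS lw sv.
  rewrite subn0 /= -size_onion_hi.
  by have -> : lo S N S = 0 by rewrite /lo subnn.
have Et : S - d = (S - d.+1).+1 by lia.
have tS : S - d.+1 < S by lia.
have stp := peel_step c l N0 tS; rewrite -Et in stp.
have moved i : upd s (other v) i (other v) = i by rewrite /upd; case: (v).
have ltP l1 l2 : ((l1.+1 * M).-1 < (l2.+1 * M).-1) = (l1 < l2).
  by have := @ltn_pmul2r M l1.+1 l2.+1 M0; lia.
have [e1 e2] : var_eqb v (other v) = false /\ var_eqb (other v) (other v) = true.
  by case: (v).
have unfold : sat (pad f p M w) s (survives f S true d.+1 v) <->
    sat (pad f p M w) s (survives f S true d v) /\
    forall i, i < size (pad f p M w) ->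
      ~ (i < size (pad f p M w) /\ nth (f (S - d)) (pad f p M w) i = f (S - d))
      \/ (if odd (S - d) then s v < i else i < s v)
      \/ sat (pad f p M w) (upd s (other v) i) (survives f S false d (other v)).
  rewrite /=; case: (odd _) => /=; split=> -[H1 H2]; split=> // i /H2;
    by rewrite e1 e2.
rewrite unfold stp (IH v l) //; last by lia.
split=> -[H1 H2]; split=> //.
  move=> l' l'w El'.
  have [||si E] := proj2 (@letter_pad (S - d) (l'.+1 * M).-1 _); first by lia.
    by exists l'.
  case: (H2 _ si) => [[]//|[]].
    by rewrite sv !ltP => ?; left.
  have m2 := moved (l'.+1 * M).-1.
  by rewrite sat_survives_neg (IH _ l') //; [right | lia].
move=> i si; case: (nth (f (S - d)) (pad f p M w) i =P f (S - d)) => [E|E].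
  right; have [|l' [l'w Ei El']] := proj1 (@letter_pad (S - d) i _) (conj si E).
    by lia.
  have m2 := moved i; rewrite {2}Ei in m2.
  rewrite sat_survives_neg (IH _ l') //; last by lia.
  by case: (H2 l' l'w El') => ?; [left; rewrite Ei sv !ltP | right].
by left=> -[].
Qed.

Lemma models_core_formula :
  models (pad f p M w) (core_formula f S) <-> 0 < c.
Proof.
have cut l : lo S N 0 <= l < c + hi S N 0 -> l < size w.
  by rewrite size_onion_hi; have := @hi_mono S N 0 S; lia.
split=> [[i [si [/= Hi Hs]]]|c0].
  have [l [lw Ei _]] := proj1 (letter_pad i (leq0n S)) Hi.
  by have := proj1 (@sat_survives S VX l _ (leqnn S) lw Ei) Hs; rewrite subnn lo_hi0; lia.
have lS : lo S N 0 <= lo S N 0 < c + hi S N 0 by rewrite lo_hi0; lia.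
have l0 : nth 0 w (lo S N 0) = 0 by have := letter_le (leq0n S) lS; lia.
have [//||si E] := proj2 (@letter_pad 0 ((lo S N 0).+1 * M).-1 _).
  by exists (lo S N 0); split=> //; apply: cut.
exists ((lo S N 0).+1 * M).-1; split=> //; split=> //.
by rewrite (@sat_survives S VX (lo S N 0)) ?subnn //; apply: cut.
Qed.

End Semantics.

(** * The separating sentence and the inseparable languages *)

Theorem theorem5p6 (m : nat) (hm : 0 < m) :
  exists (Sigma : finType) (phi : form Sigma) (K L : seq Sigma -> Prop),
    [/\ sentence phi, FO2_m m phi, separates phi K L &
        forall psi : form Sigma, sentence psi -> FO2_m m.-1 psi ->
          ~ separates psi K L].
Proof.
case: m hm => // S _.
(* The letters are 0, ..., S, and S + 1 is the padding. Below, n is the quantifier depth to be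
   withstood; the languages collect all n because they must be fixed before [psi]. *)
pose f (a : nat) : 'I_S.+2 := inord a.
pose word c n := pad f ord_max n.*2.+1 (onion (n.*2 + 3) c S).
have fv a : a <= S -> f a = a :> nat by move=> aS; rewrite inordK; lia.
have fp a : a <= S -> f a <> ord_max by move=> aS /(congr1 val) /=; rewrite fv //; lia.
have fI a b : a <= S -> b <= S -> f a = f b -> a = b.
  by move=> aS bS /(congr1 val) /=; rewrite !fv.
have coreP c n : models (word c n) (core_formula f S) <-> 0 < c.
  by apply: models_core_formula => //; lia.
exists 'I_S.+2, (core_formula f S), (fun u => exists n, u = word 1 n),
  (fun u => exists n, u = word 0 n); split.
- by split; rewrite /= ?(free_survives f S true S VX).
- exists (maxn S.+1 (qdepth (core_formula f S))); split; first exact: leq_maxl.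
  split; first exact: leq_maxr.
  by rewrite /alternation /= max0n add1n ltnS blocks_survives.
- by left; split=> u [n ->]; rewrite coreP.
move=> psi [px py] [_ [_ [_ /= alt]]] sep.
have transfer c d : models (word c (qdepth psi)) psi -> models (word d (qdepth psi)) psi.
  (* For S = 0 no quantifier is allowed in [psi], and a vacuous simulation suffices. *)
  case: (posnP S) => [S0|S0].
    have sim : simulation suc_agree (fun c => word c (qdepth psi)) S (qdepth psi)
        (fun _ _ _ _ _ _ => True).
      by split=> k *; exfalso; lia.
    exact: (sim_sentence sim).
  have sim := @onion_simulation S ((qdepth psi).*2 + 3) (qdepth psi) (leqnn _).
  have big : (qdepth psi).*2 < (qdepth psi).*2.+1 by [].
  have ne c' : 0 < size (onion ((qdepth psi).*2 + 3) c' S).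
    rewrite size_onion_hi; have [] := @onion_geometry S ((qdepth psi).*2 + 3) 0 S0.
    by move=> _ _ _ H [_ E _]; rewrite E in H; lia.
  exact: (sim_sentence (pad_simulation f ord_max sim big ne)).
have inK c : (exists n, word c (qdepth psi) = word c n) by exists (qdepth psi).
case: sep => -[H1 H2].
  by apply: (H2 _ (inK 0)); apply: transfer (H1 _ (inK 1)).
by apply: (H2 _ (inK 1)); apply: transfer (H1 _ (inK 0)).
Qed.
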